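(* Let $b\neq0$ and, given a pair $(T,\varphi)$ with $T\in\mathcal{S}'(\mathbb{R})$ and $\varphi\in\mathcal{S}(\mathbb{R})$, define $(T_b,\varphi_b)$ by $$\mathbb{E}_{T_b,\varphi_b}[\psi]:=\mathbb{E}_{T,\varphi}[\psi(b\,\cdot)]\qquad\text{and}\qquad \varphi_b(x):=\varphi(bx).$$ Let ${}^{(\varphi_b)}\phi_b$ and ${}^{(\varphi_b)}\kappa_n$ denote the weak characteristic function and the weak cumulants of $(T_b,\varphi_b)$, and ${}^{(\varphi)}\phi$ and ${}^{(\varphi)}\kappa_n$ those of $(T,\varphi)$. Then $${}^{(\varphi_b)}\phi_b(t)={}^{(\varphi)}\phi(bt)\qquad\text{and}\qquad {}^{(\varphi_b)}\kappa_n=b^n\,{}^{(\varphi)}\kappa_n .$$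
   Context: $\mathcal{S}(\mathbb{R})$ and $\mathcal{S}'(\mathbb{R})$ denote Schwartz functions and tempered distributions. For a pair $(T,\varphi)$ and $\psi$ with $\psi\varphi\in\mathcal{S}(\mathbb{R})$, the weak expectation is $\mathbb{E}_{T,\varphi}[\psi]:=\langle T,\psi\varphi\rangle$. The weak characteristic function is ${}^{(\varphi)}\phi(t):=\mathbb{E}_{T,\varphi}[e^{itx}]=\langle T,e^{itx}\varphi(x)\rangle$. When it is nonzero in a neighbourhood of $0$, the weak cumulant generating function is ${}^{(\varphi)}K(t):=\log{}^{(\varphi)}\phi(t)$, and the $n$-th weak cumulant ($n\ge1$) is ${}^{(\varphi)}\kappa_n:=i^{-n}\frac{d^n}{dt^n}{}^{(\varphi)}K(t)\big|_{t=0}$. *)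

(* Defs.v *)
From HB Require Import structures.
From mathcomp Require Import all_boot all_order all_algebra.
From mathcomp Require Import all_classical all_reals all_analysis.
From mathcomp Require Import complex.

Set Implicit Arguments.
Unset Strict Implicit.
Unset Printing Implicit Defensive.

Import Order.TTheory GRing.Theory Num.Theory.
Import numFieldNormedType.Exports.
Import ComplexField.Normc.

Local Open Scope ring_scope.
Local Open Scope complex_scope.
Local Open Scope classical_set_scope.

Section complex_valued.
Context {R : realType}.
Implicit Types (f : R -> R[i]) (n k : nat) (x : R).

(* The library has no structure of normed space over R on R[i]: the analysis
   of complex-valued functions of a real variable is done componentwise. *)
Definition re_part f : R -> R := fun x => complex.Re (f x).
Definition im_part f : R -> R := fun x => complex.Im (f x).

Definition cderive n f : R -> R[i] :=
  fun x => derive1n n (re_part f) x +i* derive1n n (im_part f) x.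

Definition csmooth f := forall n x,
  derivable (derive1n n (re_part f)) x 1 /\
  derivable (derive1n n (im_part f)) x 1.

Definition ccontinuous_at f x :=
  {for x, continuous (re_part f)} /\ {for x, continuous (im_part f)}.

Definition dilate (b : R) f : R -> R[i] := fun x => f (b * x).

Definition cexp (z : R[i]) : R[i] :=
  (expR (complex.Re z) * cos (complex.Im z))
  +i* (expR (complex.Re z) * sin (complex.Im z)).

Definition is_schwartz f :=
  csmooth f /\
  forall k n, exists M : R, forall x, `|x| ^+ k * normc (cderive n f x) <= M.

Definition schwartz_pred : {pred R -> R[i]} := [pred f | `[< is_schwartz f >]].

Lemma cderiveD n f g : csmooth f -> csmooth g ->
  derive1n n (re_part (f + g)) =
    derive1n n (re_part f) + derive1n n (re_part g) /\
  derive1n n (im_part (f + g)) =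
    derive1n n (im_part f) + derive1n n (im_part g).
Proof.
move=> sf sg; elim: n => [|n [IHr IHi]].
  by split; apply/funext => x; rewrite !derive1n0 /re_part /im_part !fctE;
     case: (f x) (g x) => [? ?] [? ?].
split; apply/funext => x; rewrite !derive1nS ?IHr ?IHi !fctE !derive1E deriveD //.
- by case: (sf n x).
- by case: (sg n x).
- by case: (sf n x).
- by case: (sg n x).
Qed.

Lemma cderiveZ n f (a : R[i]) : csmooth f ->
  derive1n n (re_part (a *: f)) =
    complex.Re a *: derive1n n (re_part f)
    - complex.Im a *: derive1n n (im_part f) /\
  derive1n n (im_part (a *: f)) =
    complex.Re a *: derive1n n (im_part f)
    + complex.Im a *: derive1n n (re_part f).
Proof.
move=> sf; elim: n => [|n [IHr IHi]].
  split; apply/funext => x; rewrite !derive1n0 /re_part /im_part !fctE;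
    by case: a (f x) => [? ?] [? ?].
split; apply/funext => x; rewrite !derive1nS ?IHr ?IHi !fctE !derive1E;
  have [dr di] := sf n x.
- by rewrite deriveB ?deriveZ//; exact: derivableZ.
- by rewrite deriveD ?deriveZ//; exact: derivableZ.
Qed.

Lemma schwartz_submod_closed : submod_closed schwartz_pred.
Proof.
have E0 n : derive1n n (re_part (0 : R -> R[i])) = cst 0 /\
            derive1n n (im_part (0 : R -> R[i])) = cst 0.
  elim: n => [//|n [IHr IHi]].
  by split; apply/funext => x; rewrite derive1nS ?IHr ?IHi derive1_cst.
have sm0 : csmooth (0 : R -> R[i]).
  by move=> n x; have [E1 E2] := E0 n; split; rewrite ?E1 ?E2.
have smZ (a : R[i]) f : csmooth f -> csmooth (a *: f).
  move=> sf n x; have [-> ->] := cderiveZ n a sf; have [dr di] := sf n x.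
  by split; [apply: derivableB|apply: derivableD]; exact: derivableZ.
split=> [|a f g].
  apply/asboolP; split=> // k n; exists 0 => x.
  by have [E1 E2] := E0 n; rewrite /cderive E1 ?E2 normc0 mulr0.
move=> /asboolP[sf bf] /asboolP[sg bg]; apply/asboolP.
have saf := smZ a _ sf.
split=> [n x|k n].
  have [-> ->] := cderiveD n saf sg; have [dr di] := saf n x.
  by have [dr' di'] := sg n x; split; exact: derivableD.
have [M hM] := bf k n; have [M' hM'] := bg k n.
exists (normc a * M + M') => x.
have [E1 E2] := cderiveD n saf sg; have [E3 E4] := cderiveZ n a sf.
have -> : cderive n (a *: f + g) x = a * cderive n f x + cderive n g x.
  by rewrite /cderive E1 E2 !fctE E3 E4 !fctE; case: (a).
apply: le_trans (_ : `|x| ^+ k * (normc a * normc (cderive n f x)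
                                  + normc (cderive n g x)) <= _).
  by rewrite -normcM ler_wpM2l ?exprn_ge0 ?le_normcD.
rewrite mulrDr mulrCA lerD ?hM' // ler_wpM2l ?hM //.
by case: (a) => u v /=; rewrite sqrtr_ge0.
Qed.

HB.instance Definition _ := GRing.isSubmodClosed.Build R[i] (R -> R[i])
  schwartz_pred schwartz_submod_closed.

End complex_valued.

Record schwartz (R : realType) := Schwartz {
  schwartz_fun :> R -> R[i];
  _ : schwartz_fun \in schwartz_pred }.

HB.instance Definition _ (R : realType) :=
  [isSub for @schwartz_fun R].
HB.instance Definition _ (R : realType) :=
  [Choice of schwartz R by <:].
HB.instance Definition _ (R : realType) :=
  [SubChoice_isSubLmodule of schwartz R by <:].

Section weak_probability.
Context {R : realType}.
Implicit Types (f g : schwartz R).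

Definition schwartz_seminorm (k n : nat) f : R :=
  sup (range (fun x : R => `|x| ^+ k * normc (cderive n f x))).

(* Continuity for the locally convex topology defined by the seminorms. *)
Definition schwartz_continuous (T : schwartz R -> R[i]) :=
  forall f (e : R), 0 < e -> exists N : nat, exists2 d : R, 0 < d &
    forall g, (forall k n, (k <= N)%N -> (n <= N)%N ->
                 schwartz_seminorm k n (g - f) < d) ->
      normc (T g - T f) < e.

End weak_probability.

Record tempered (R : realType) := Tempered {
  tempered_fun :> {scalar schwartz R};
  tempered_continuous : schwartz_continuous tempered_fun }.

Section weak_expectation.
Context {R : realType}.
Implicit Types (T : tempered R) (phi : schwartz R) (psi : R -> R[i]).
Implicit Types (E : (R -> R[i]) -> R[i]) (K : R -> R[i]) (n : nat).

(* <T, psi phi>; meaningful when psi * phi is a Schwartz function, and 0 by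
   convention otherwise. *)
Definition weak_expectation T phi psi : R[i] :=
  T (insubd (0 : schwartz R) (psi * (phi : R -> R[i]))).

(* The characteristic function and the cumulants of a pair depend only on its
   weak expectation functional E, which is taken as the parameter below. The
   functional psi |-> E_{T,phi}[psi(b .)] need not be the weak expectation of
   a pair (T_b, phi(b .)) with T_b tempered: its value is not in general a
   function of the product of psi and phi(b .), for instance when
   |b| > 1 and phi has compact support. *)
Definition weak_charfun E (t : R) : R[i] :=
  E (fun x => cexp ('i * (t * x)%:C)).

(* K is a local determination of the logarithm of the weak characteristic
   function: the principal logarithm would not do when the value at 0 lies on
   its cut. *)
Definition is_weak_cgf E K :=
  \forall t \near (0 : R),
    ccontinuous_at K t /\ cexp (K t) = weak_charfun E t.

Definition weak_cgf E : R -> R[i] := xget (fun=> 0) (is_weak_cgf E).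

(* Two determinations differ by a constant near 0, hence the n-th cumulant,
   n >= 1, does not depend on the one that is chosen. *)
Definition weak_cumulant E n : R[i] := 'i ^- n * cderive n (weak_cgf E) 0.

End weak_expectation.

(* Main.v *)
(* Multiplication by e^{itx} preserves Schwartz functions because it intertwines
   d/dx with f |-> f' + i t f; hence e^{itx} is an admissible test function, and
   its dilation by b is e^{ibtx}. For the cumulants, t |-> K(bt) is a logarithm
   of the characteristic function of the dilated pair near 0 as soon as K is one
   for the original pair. Two such logarithms differ by a constant near 0, by
   continuity at 0 and discreteness of 2 pi i Z, so that their derivatives of
   order n >= 1 agree there. *)
Require Import Defs.
From mathcomp Require Import all_boot all_order all_algebra.
From mathcomp Require Import all_classical all_reals all_analysis.
From mathcomp Require Import complex ring.

Set Implicit Arguments.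
Unset Strict Implicit.
Unset Printing Implicit Defensive.

Import Order.TTheory GRing.Theory Num.Theory.
Import numFieldNormedType.Exports.

Local Open Scope ring_scope.
Local Open Scope complex_scope.
Local Open Scope classical_set_scope.

(** * Iterated derivatives: dilations and local equality *)

Lemma is_derive_dilate (R : realType) (a b : R) (f : R -> R) (x : R) :
  derivable f (b * x) 1 ->
  is_derive x 1 (fun y => a * f (b * y)) (a * (b * (f^`() (b * x))%classic)).
Proof.
move=> df.
have db : is_derive x 1 ( *%R b) b.
  have := @is_deriveZ R R R id b x 1 1 (is_derive_id x 1).
  by rewrite [b *: 1]mulr1.
have dfb : is_derive (b * x) 1 f (f^`() (b * x))%classic.
  by rewrite derive1E; exact: derivableP.
by rewrite [b * _]mulrC; exact: is_deriveZ (is_derive1_comp dfb db).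
Qed.

(** The derivative is a [lim], whose value on a divergent filter is the default point [0]. *)
Lemma derive1_nonderivable (R : realType) (f : R -> R) (x : R) :
  ~ derivable f x 1 -> f^`() x = 0.
Proof. by move=> nd; rewrite derive1E /derive dvgP. Qed.

(* Holds with no hypothesis on [f], whose derivative is [0] at the points where
   it does not exist. *)
Lemma derive1_dilate (R : realType) (a b : R) (f : R -> R) (x : R) :
  a != 0 -> b != 0 ->
  (fun y => a * f (b * y))^`() x = a * (b * (f^`() (b * x))%classic).
Proof.
move=> a0 b0; have [df|ndf] := pselect (derivable f (b * x) 1).
  by rewrite derive1E; have H := is_derive_dilate a df; exact: derive_val.
(* A derivative of the dilation at [x] would give one of [f] at [b * x], as [f] is recovered by
   dilating by [b^-1] and scaling by [a^-1]. *)
rewrite (derive1_nonderivable ndf) !mulr0; apply: derive1_nonderivable => df.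
apply: ndf; rewrite -[x](mulKf b0) in df.
have := @ex_derive _ _ _ _ _ _ _ (is_derive_dilate a^-1 df).
have -> // : (fun y => a^-1 * (a * f (b * (b^-1 * y)))) = f.
by apply/funext => y; rewrite mulVKf// mulKf.
Qed.

Lemma derive1n_dilate (R : realType) (b : R) (f : R -> R) n : b != 0 ->
  (fun y => f (b * y))^`(n) = (fun x => b ^+ n * (f^`(n) (b * x))%classic).
Proof.
move=> b0; elim: n => [|n IH].
  by apply/funext => x; rewrite !derive1n0 expr0 mul1r.
apply/funext => x; rewrite !derive1nS IH derive1_dilate ?expf_neq0//.
by rewrite exprSr mulrA.
Qed.

(** The conclusion is kept on a neighbourhood, because each further derivative needs the equality
    around every nearby point. *)
Lemma near_derive1n (R : realType) (f g : R -> R) (x : R) n :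
  (\forall y \near x, f y = g y) -> \forall y \near x, f^`(n) y = g^`(n) y.
Proof.
move=> fg; elim: n => [//|n IH]; have := near_join IH.
by apply: filterS => y fgy; rewrite !derive1nS !derive1E; exact: near_eq_derive.
Qed.

Lemma near_derive1n_addC (R : realType) (f g : R -> R) (c x : R) n : (0 < n)%N ->
  (\forall y \near x, f y = g y + c) -> f^`(n) x = g^`(n) x.
Proof.
case: n => // n _ fg.
rewrite (nbhs_singleton (@near_derive1n _ f (fun y => g y + c)%R x n.+1 fg)).
have -> // : (fun y => g y + c)^`(n.+1) = g^`(n.+1).
rewrite !derive1Sn; congr (derive1n n _); apply/funext => y.
(* The constant cancels in the difference quotient itself, so [g] need not be derivable. *)
rewrite /derive1 (_ : (fun h => _) = (fun h => h^-1 *: (g (h + y) - g y)))//.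
by apply/funext => h; rewrite opprD addrACA subrr addr0.
Qed.

(** * Fibres of the complex exponential *)

Section cexp.
Variable R : realType.
Implicit Types (z w : R[i]) (s : R).

Lemma normc_cexp z : Normc.normc (cexp z) = expR (complex.Re z).
Proof.
rewrite /cexp /= !exprMn -mulrDr cos2Dsin2 mulr1 sqrtr_sqr.
by rewrite ger0_norm// expR_ge0.
Qed.

(** Comparing moduli gives the real parts; dividing by the modulus leaves equal cosines and
    sines. *)
Lemma cexp_eq z w : cexp z = cexp w ->
  [/\ complex.Re z = complex.Re w, cos (complex.Im z - complex.Im w) = 1
    & sin (complex.Im z - complex.Im w) = 0].
Proof.
move=> zw; have rzw : complex.Re z = complex.Re w.
  by apply: expR_inj; rewrite -!normc_cexp zw.
have e0 : expR (complex.Re w) != 0 by rewrite gt_eqF ?expR_gt0.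
case: zw; rewrite rzw => /(mulfI e0) cE /(mulfI e0) sE.
by split; rewrite // ?cosB ?sinB cE sE -?expr2 ?cos2Dsin2// mulrC subrr.
Qed.

(** Discreteness of [2 pi Z]: [cos] is even, and injective on [[0, pi]]. *)
Lemma cos_eq1 s : `|s| <= pi -> cos s = 1 -> s = 0.
Proof.
rewrite -cos_norm -[1]cos0 => s_pi /cos_inj s0; apply/eqP.
by rewrite -normr_eq0 s0// in_itv/= ?normr_ge0// lexx pi_ge0.
Qed.

Lemma cexp_im s : cexp ('i * s%:C) = cos s +i* sin s.
Proof.
have -> : 'i * s%:C = 0 +i* s by simpc.
by rewrite /cexp /= expR0 !mul1r.
Qed.

End cexp.

(** * Logarithms and cumulants under dilation *)

Section cumulants.
Variable R : realType.
Implicit Types (E : (R -> R[i]) -> R[i]) (K : R -> R[i]) (b t : R).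

(* The imaginary parts differ by an element of [2 pi Z], and their difference is
   continuous at [0]. *)
Lemma cexp_near_const K L : ccontinuous_at K 0 -> ccontinuous_at L 0 ->
  (\forall t \near (0 : R), cexp (K t) = cexp (L t)) ->
  (\forall t \near (0 : R), re_part K t = re_part L t) /\
  (\forall t \near (0 : R),
     im_part K t = im_part L t + (im_part K 0 - im_part L 0)).
Proof.
move=> [_ cK] [_ cL] KL.
split; first by apply: filterS KL => t /cexp_eq[].
have [_ c0 _] := cexp_eq (nbhs_singleton KL).
pose D t := im_part K t - im_part L t.
have cD : D t @[t --> (0 : R)] --> D 0 by apply: cvgB.
(* The tolerance [pi] is below the spacing [2 pi] and within the range of [cos_eq1]. *)
have /cvgrPdist_le/(_ _ (pi_gt0 R)) near0 := cD.
apply: filterS2 KL near0 => t /cexp_eq[_ ct st] /cos_eq1 D0.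
suff /eqP : D 0 - D t = 0 by rewrite subr_eq0 /D => /eqP ->; rewrite addrC subrK.
by apply: D0; rewrite cosB [cos (D t)]ct [sin (D t)]st [cos _]c0 mulr1 mulr0 addr0.
Qed.

Lemma is_weak_cgf_dilate E F b K : b != 0 ->
  (forall t, weak_charfun F t = weak_charfun E (b * t)) ->
  is_weak_cgf E K -> is_weak_cgf F (dilate b K).
Proof.
move=> b0 FE cK; have bc : b * t @[t --> (0 : R)] --> (0 : R).
  by rewrite -[X in _ --> X](mulr0 b); exact: mulrl_continuous.
have {}cK : \forall t \near (0 : R),
    ccontinuous_at K (b * t) /\ cexp (K (b * t)) = weak_charfun E (b * t).
  exact: bc cK.
apply: filterS cK => t [[cr ci] eK]; split; last first.
  by rewrite FE -eK.
have cb : {for t, continuous ( *%R b)} by apply: mulrl_continuous.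
split; first exact: (@continuous_comp R R R ( *%R b) (re_part K) t cb cr).
exact: (@continuous_comp R R R ( *%R b) (im_part K) t cb ci).
Qed.

(** [E] and [F] are arbitrary functionals, so that both parts of the theorem are instances. *)
Lemma weak_cumulant_dilate E F b n : b != 0 -> (0 < n)%N ->
  (forall t, weak_charfun F t = weak_charfun E (b * t)) ->
  weak_cumulant F n = b%:C ^+ n * weak_cumulant E n.
Proof.
move=> b0 n0 FE; rewrite /weak_cumulant mulrCA; congr (_ * _).
have EF t : weak_charfun E t = weak_charfun F (b^-1 * t) by rewrite FE mulVKf.
(* The factor [b ^+ n] comes from differentiating the dilation, and [b * 0 = 0] keeps the base
   point. *)
suff : cderive n (weak_cgf F) 0 = cderive n (dilate b (weak_cgf E)) 0.
  move=> ->; rewrite /cderive.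
  rewrite (derive1n_dilate (re_part (weak_cgf E)))//.
  rewrite (derive1n_dilate (im_part (weak_cgf E)))// mulr0.
  by rewrite -rmorphXn /=; simpc.
(* The logarithm [L] chosen for [F] need not be the dilation of the one chosen for [E]. *)
rewrite /weak_cgf; case: xgetP => [L _ cL|nL].
  case: xgetP => [K _ cK|nK]; last first.
    (* Dilating [L] by [b^-1] would give a logarithm for [E]. *)
    by have := is_weak_cgf_dilate (invr_neq0 b0) EF cL => /nK.
  have {}cK := is_weak_cgf_dilate b0 FE cK.
  have [[ccL _] [ccK _]] := (nbhs_singleton cL, nbhs_singleton cK).
  have [|re_eq im_eq] := cexp_near_const ccL ccK.
    by apply: filterS2 cL cK => t [_ ->] [_ ->].
  rewrite /cderive (near_derive1n_addC n0 im_eq).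
  by rewrite (nbhs_singleton (near_derive1n n re_eq)).
(* With no logarithm on either side, both generating functions default to [0]. *)
rewrite xgetPN// => K cK; exact: nL _ (is_weak_cgf_dilate b0 FE cK).
Qed.

End cumulants.

(** * Stability of Schwartz functions under modulation *)

Section modulation.
Variable R : realType.
Implicit Types (f : R -> R[i]) (t x : R).

Definition wave t : R -> R[i] := fun x => cexp ('i * (t * x)%:C).

Lemma re_part_wave t f :
  re_part (wave t * f) =
    (fun x => cos (t * x) * re_part f x - sin (t * x) * im_part f x).
Proof.
by apply/funext => x; rewrite /re_part /im_part !fctE /wave cexp_im; case: (f x).
Qed.

Lemma im_part_wave t f :
  im_part (wave t * f) =
    (fun x => cos (t * x) * im_part f x + sin (t * x) * re_part f x).
Proof.
by apply/funext => x; rewrite /re_part /im_part !fctE /wave cexp_im; case: (f x).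
Qed.

Lemma is_derive_cos_dilate t x :
  is_derive x 1 (fun y => cos (t * y)) (- (t * sin (t * x))).
Proof.
have := @is_derive_dilate R 1 t cos x (@derivable_cos R _).
rewrite derive1E derive_val mul1r mulrN.
by under eq_fun do rewrite mul1r.
Qed.

Lemma is_derive_sin_dilate t x :
  is_derive x 1 (fun y => sin (t * y)) (t * cos (t * x)).
Proof.
have := @is_derive_dilate R 1 t sin x (@derivable_sin R _).
rewrite derive1E derive_val mul1r.
by under eq_fun do rewrite mul1r.
Qed.

Lemma schwartz_cderive1 f : is_schwartz f -> is_schwartz (cderive 1 f).
Proof.
have cd n : (re_part (cderive 1 f))^`(n) = (re_part f)^`(n.+1) /\
            (im_part (cderive 1 f))^`(n) = (im_part f)^`(n.+1).
  by rewrite !derive1Sn -!derive1n1.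
move=> [sf bf]; split=> [n x|k n]; first by have [-> ->] := cd n; exact: sf.
have [M hM] := bf k n.+1; exists M => x.
by have [E1 E2] := cd n; rewrite /cderive E1 E2; exact: hM.
Qed.

Definition wave_cderive t f : R -> R[i] := ('i * t%:C) *: f + cderive 1 f.

Lemma schwartz_wave_cderive t f :
  is_schwartz f -> is_schwartz (wave_cderive t f).
Proof.
move=> sf; apply/asboolP; have [_ linS] := @schwartz_submod_closed R.
apply: linS; apply/asboolP => //; exact: schwartz_cderive1.
Qed.

Lemma is_derive_wave t f x : csmooth f ->
  is_derive x 1 (re_part (wave t * f)) (re_part (wave t * wave_cderive t f) x) /\
  is_derive x 1 (im_part (wave t * f)) (im_part (wave t * wave_cderive t f) x).
Proof.
move=> sf; have [] := sf 0%N x; rewrite !derive1n0 => dr di.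
have /derivableP dfr := dr; have /derivableP dfi := di.
have dc := is_derive_cos_dilate t x; have ds := is_derive_sin_dilate t x.
have rh : re_part (wave_cderive t f) x = 'D_1 (re_part f) x - t * im_part f x.
  rewrite -derive1E /wave_cderive /cderive !derive1n1 /re_part /im_part !fctE.
  case: (f x) => u v /=; ring.
have ih : im_part (wave_cderive t f) x = 'D_1 (im_part f) x + t * re_part f x.
  rewrite -derive1E /wave_cderive /cderive !derive1n1 /re_part /im_part !fctE.
  case: (f x) => u v /=; ring.
rewrite !re_part_wave !im_part_wave rh ih; split.
  apply: (is_derive_eq (is_deriveB (is_deriveM dc dfr) (is_deriveM ds dfi))).
  rewrite /GRing.scale /=; ring.
apply: (is_derive_eq (is_deriveD (is_deriveM dc dfi) (is_deriveM ds dfr))).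
rewrite /GRing.scale /=; ring.
Qed.

(** The witness is the [n]-th iterate of [wave_cderive t] on [f]; only its being Schwartz matters
    later. *)
Lemma derive1n_wave t n f : is_schwartz f ->
  exists2 h, is_schwartz h &
    (re_part (wave t * f))^`(n) = re_part (wave t * h) /\
    (im_part (wave t * f))^`(n) = im_part (wave t * h).
Proof.
elim: n => [|n IH] sf; first by exists f.
have [h sh [Er Ei]] := IH sf; exists (wave_cderive t h).
  exact: schwartz_wave_cderive.
by split; apply/funext => x; rewrite derive1nS ?Er ?Ei derive1E;
   have [dr di] := is_derive_wave t x sh.1; exact: derive_val.
Qed.

Lemma schwartz_wave t f : is_schwartz f -> is_schwartz (wave t * f).
Proof.
move=> sf; split=> [n x|k n].
  have [h sh [-> ->]] := derive1n_wave t n sf.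
  by have [dr di] := is_derive_wave t x sh.1; split; exact: ex_derive.
have [h sh [Er Ei]] := derive1n_wave t n sf.
(* Since [wave t] has modulus 1, the bound on [h] itself, at order 0, is the one sought. *)
have [M hM] := sh.2 k 0%N; exists M => x; rewrite /cderive Er Ei.
have -> : re_part (wave t * h) x +i* im_part (wave t * h) x = wave t x * h x.
  by rewrite /re_part /im_part fctE; case: (_ * _).
have wave1 : Normc.normc (wave t x) = 1.
  by rewrite /wave cexp_im /= cos2Dsin2 sqrtr1.
rewrite Normc.normcM wave1 mul1r.
have := hM x; rewrite /cderive !derive1n0 /re_part /im_part.
by case: (h x).
Qed.

End modulation.

(* First part: every pair (Tb, phib) such that E_{Tb,phib}[psi] equals
   E_{T,phi}[psi(b .)] as soon as both sides are meaningful. Second part: the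
   expectation of (T_b, phi_b) is by definition psi |-> E_{T,phi}[psi(b .)],
   also when no tempered T_b represents it. *)
Theorem proposition3p9 (R : realType) (b : R) (hb : b != 0)
    (T : tempered R) (phi : schwartz R) :
  let E := weak_expectation T phi in
  (forall (Tb : tempered R) (phib : schwartz R),
     let Eb := weak_expectation Tb phib in
     (forall x, phib x = phi (b * x)) ->
     (forall psi : R -> R[i],
        is_schwartz (psi * (phib : R -> R[i])) ->
        is_schwartz (dilate b psi * (phi : R -> R[i])) ->
        Eb psi = E (dilate b psi)) ->
     (forall t : R, weak_charfun Eb t = weak_charfun E (b * t)) /\
     ((\forall t \near (0 : R), weak_charfun E t != 0) ->
      forall n : nat, (1 <= n)%N ->
        weak_cumulant Eb n = b%:C ^+ n * weak_cumulant E n)) /\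
  (let Eb := fun psi : R -> R[i] => E (dilate b psi) in
     (forall t : R, weak_charfun Eb t = weak_charfun E (b * t)) /\
     ((\forall t \near (0 : R), weak_charfun E t != 0) ->
      forall n : nat, (1 <= n)%N ->
        weak_cumulant Eb n = b%:C ^+ n * weak_cumulant E n)).
Proof.
move=> E; split; last first.
  move=> Eb; have FE t : weak_charfun Eb t = weak_charfun E (b * t).
    rewrite /weak_charfun /Eb /E; congr (weak_expectation _ _ _).
    by apply/funext => x; rewrite /dilate mulrCA mulrA.
  by split=> // _ n n0; exact: weak_cumulant_dilate.
move=> Tb phib Eb phibE EbE.
have schw (f : schwartz R) : is_schwartz f by apply/asboolP; exact: valP f.
have FE t : weak_charfun Eb t = weak_charfun E (b * t).
  have dw : dilate b (wave t) = wave (b * t).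
    by apply/funext => x; rewrite /dilate /wave mulrCA mulrA.
  (* Both admissibility conditions concern a wave times a Schwartz function: [wave t * phib] and
     [wave (b * t) * phi]. *)
  rewrite /weak_charfun EbE ?dw//; exact: schwartz_wave.
by split=> // _ n n0; exact: weak_cumulant_dilate.
Qed.
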